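(* Let $\mathcal D=(\mathcal P,\mathcal B)$ be a resolvable $2$-$(v,t,1)$-design with resolution $\{\mathcal B_1,\dots,\mathcal B_\ell\}$. Let $H$ be the graph with vertex set $\mathcal B$ in which two distinct blocks $B_1,B_2$ are adjacent if and only if $B_1\cap B_2\neq\emptyset$ or there exists $i$ with $B_1,B_2\in\mathcal B_i$. Then $H$ is regular with valency $\frac{v-t}{t-1}\left(t+\frac{t-1}{t}\right)$ and co-edge-regular of level $2$ with parameter $t(t+2)$. Moreover, the spectrum of $H$ is $$\left\{\left[\tfrac{v-t}{t-1}\left(t+\tfrac{t-1}{t}\right)\right]^1,\ \left[\tfrac{v-t}{t}-t\right]^{f_1},\ \left[\tfrac{v-1}{t-1}-t-2\right]^{f_2},\ [-t-1]^{f_3}\right\},$$ where $f_1=\frac{v-t}{t-1}$, $f_2=v-1$, and $f_3=\frac{v-1}{t}\left(\frac{v-t}{t-1}-t\right)$ (superscripts are multiplicities).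
   Context: A $2$-$(v,t,1)$-design is a pair $(\mathcal P,\mathcal B)$ with $|\mathcal P|=v$, where $\mathcal B$ is a collection of $t$-subsets (blocks) of $\mathcal P$ such that every pair of distinct points lies in exactly one block. It is resolvable if $\mathcal B$ can be partitioned into parts $\mathcal B_1,\dots,\mathcal B_\ell$ such that each $\mathcal B_i$ is a partition of $\mathcal P$; such a partition of $\mathcal B$ is called a resolution. Graphs are finite and simple; spectrum means adjacency spectrum. For adjacent vertices $x,y$, $\lambda(x,y)$ is the number of common neighbours. A regular graph is co-edge-regular with parameter $\mu$ if any two distinct non-adjacent vertices have exactly $\mu$ common neighbours; it has level $m$ if $\#\{\lambda(x,y)\mid x,y\text{ adjacent}\}=m$.
   Formalization: The formal theorem assumes 2 ≤ t < v (otherwise the formulas are undefined or fail, e.g. f_3 < 0 for v = t) and claims level 2 only for v ≠ t², since for v = t² (affine planes) H is complete and has level 1. *)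

(* Defs.v *)
From mathcomp Require Import all_boot all_order all_algebra.

Set Implicit Arguments.
Unset Strict Implicit.
Unset Printing Implicit Defensive.

Import GRing.Theory.
Local Open Scope ring_scope.

(** * Finite simple graphs *)

Record sgraph := SGraph {
  vertex :> finType;
  adj : rel vertex;
  adj_sym : symmetric adj;
  adj_irrefl : irreflexive adj }.

Arguments adj {s}.

Definition common_nbrs (G : sgraph) (x y : G) : nat :=
  #|[set z | adj x z && adj y z]|.

Definition regular_graph (G : sgraph) (k : nat) : Prop :=
  forall x : G, #|[set y | adj x y]| = k.

Definition co_edge_regular (G : sgraph) (mu : nat) : Prop :=
  (exists k, regular_graph G k) /\
  forall x y : G, x != y -> ~~ adj x y -> common_nbrs x y = mu.

Definition level (G : sgraph) : nat :=
  size (undup [seq common_nbrs p.1 p.2 | p <- enum [pred p : G * G | adj p.1 p.2]]).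

Definition adjmx (R : nzRingType) (G : sgraph) : 'M[R]_#|G| :=
  \matrix_(i, j) (adj (enum_val i) (enum_val j))%:R.

(* The list [s], taken up to permutation, enumerates the eigenvalues of the
   adjacency matrix with multiplicity; in particular all of them lie in [R]. *)
Definition spectrum (R : comNzRingType) (G : sgraph) (s : seq R) : Prop :=
  char_poly (adjmx R G) = \prod_(a <- s) ('X - a%:P).

(** * Designs *)

Definition design2 (P : finType) (v t : nat) (B : {set {set P}}) : Prop :=
  [/\ #|P| = v,
      forall b, b \in B -> #|b| = t
    & forall x y : P, x != y ->
        #|[set b in B | (x \in b) && (y \in b)]| = 1%N].

Definition resolution (P : finType) (B : {set {set P}})
    (Q : {set {set {set P}}}) : Prop :=
  partition Q B /\ forall C, C \in Q -> partition C [set: P].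

(** * The graph on the blocks of a resolved design *)

Section BlockGraph.
Variables (P : finType) (B : {set {set P}}) (Q : {set {set {set P}}}).

Definition block_adj : rel {b : {set P} | b \in B} :=
  fun b1 b2 => (b1 != b2) &&
    ((val b1 :&: val b2 != set0)
     || [exists C in Q, (val b1 \in C) && (val b2 \in C)]).

Lemma block_adj_sym : symmetric block_adj.
Proof.
move=> b1 b2; rewrite /block_adj eq_sym setIC; congr (_ && (_ || _)).
by apply: eq_existsb => C; rewrite [(val b1 \in C) && _]andbC.
Qed.

Lemma block_adj_irrefl : irreflexive block_adj.
Proof. by move=> b; rewrite /block_adj eqxx. Qed.

Definition block_graph : sgraph := SGraph block_adj_sym block_adj_irrefl.

End BlockGraph.

(* Main.v *)
(** Let [N] and [C] be the point-block and class-block incidence matrices,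
    [U = N^T N], [W = C^T C] and [J] the all-one matrix.  The adjacency matrix of
    [H] is [A = U + W - (t + 1) I].  With [r = (v - 1) / (t - 1)] and [c = v / t],
    the design axioms read [N N^T = (r - 1) I + J], [C C^T = c I], [N C^T = J],
    so [U], [W], [J] span a commutative algebra.  Expanding [A^2] in it gives all
    degrees and numbers of common neighbours at once.  Its primitive idempotents
    are explicit combinations of [U], [W], [J] and [I]; they diagonalise [A], and
    the multiplicity of each eigenvalue is the rank, hence the trace, of the
    corresponding idempotent. *)

Require Import Defs.
From mathcomp Require Import all_boot all_order all_algebra ring.

Set Implicit Arguments.
Unset Strict Implicit.
Unset Printing Implicit Defensive.

Import GRing.Theory Num.Theory.
Local Open Scope ring_scope.

(** * Characteristic polynomials from orthogonal idempotents *)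

Lemma det_add1mxC (R : comNzRingType) (m n : nat) (A : 'M[R]_(m, n))
    (B : 'M[R]_(n, m)) :
  \det (1%:M + A *m B) = \det (1%:M + B *m A).
Proof.
(* Sylvester's identity: both products below equal the block matrix with rows [1, -A] and [B, 1],
   and [L] has determinant 1. *)
pose L : 'M[R]_(m + n) := block_mx 1%:M 0 B 1%:M.
have /(congr1 determinant) :
    block_mx (1%:M + A *m B) (- A) 0 1%:M *m L
      = L *m block_mx 1%:M (- A) 0 (1%:M + B *m A).
  by rewrite !mulmx_block !(mul1mx, mulmx1, mul0mx, mulmx0, mulNmx, mulmxN)
             ?(addr0, add0r, addrK, addNKr, subr0) addrC addrK.
by rewrite !det_mulmx !det_ublock det_lblock !det1 !(mulr1, mul1r).
Qed.

Section Idempotents.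
Variables (F : fieldType) (n : nat).
Implicit Types (E : 'M[F]_n) (p : {poly F}).

(** In the rank factorisation [E = col_base E *m row_base E], the equation [E *m E = E] lets
    [col_base E] be cancelled on the left and [row_base E] on the right. *)
Lemma row_base_col_base_idempotent E :
  E *m E = E -> row_base E *m col_base E = 1%:M.
Proof.
move=> EE; apply: (row_full_inj (col_base_full E)).
apply: (row_free_inj (row_base_free E)).
by rewrite mulmx1 mulmx_base mulmxA mulmx_base -mulmxA mulmx_base.
Qed.

Lemma mxtrace_idempotent E : E *m E = E -> \tr E = (\rank E)%:R.
Proof.
move=> /row_base_col_base_idempotent EE.
by rewrite -{1}[E]mulmx_base mxtrace_mulC EE mxtrace1.
Qed.

(** Swapping the two rank factors by Sylvester's identity leaves a scalar matrix of size
    [\rank E]. *)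
Lemma det_add1_idempotent p E :
  E *m E = E -> \det (1%:M + p *: map_mx polyC E) = (1 + p) ^+ \rank E.
Proof.
move=> /row_base_col_base_idempotent EE.
rewrite -{1}[E]mulmx_base map_mxM scalemxAl det_add1mxC -scalemxAr -map_mxM EE.
by rewrite map_mx1 scalemx1 -raddfD det_scalar.
Qed.

(** The matrix is the product of the factors [1 + x.1 E_x], since every cross term contains a
    vanishing product of an earlier idempotent by a later one. *)
Lemma det_add1_idempotents (s : seq ({poly F} * 'M[F]_n)) :
    {in s, forall x, x.2 *m x.2 = x.2} ->
    pairwise (fun x y => x.2 *m y.2 == 0) s ->
  \det (1%:M + \sum_(x <- s) x.1 *: map_mx polyC x.2)
    = \prod_(x <- s) (1 + x.1) ^+ \rank x.2.
Proof.
elim: s => [|x s IHs] idem; first by rewrite !big_nil addr0 det1.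
rewrite pairwise_cons => /andP[/allP x_s s_s].
rewrite !big_cons -IHs //; last by move=> y ys; apply: idem; rewrite inE ys orbT.
rewrite -det_add1_idempotent ?idem ?mem_head // -det_mulmx mulmxDl mul1mx.
rewrite mulmxDr mulmx1 mulmx_sumr
  [X in _ = \det (_ + (_ + X))]big_seq [X in _ = \det (_ + (_ + X))]big1 => [|y ys].
  by rewrite addr0 addrCA addrC.
by rewrite -scalemxAl -scalemxAr -map_mxM (eqP (x_s _ ys)) map_mx0 !scaler0.
Qed.

(** As the idempotents sum to 1, [X - sum a E] equals [sum (X - a) E], that is
    [1 + sum (X - a - 1) E], which has the shape of the previous determinant. *)
Lemma char_poly_idempotents (s : seq (F * 'M[F]_n)) :
    {in s, forall x, x.2 *m x.2 = x.2} ->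
    pairwise (fun x y => x.2 *m y.2 == 0) s ->
    \sum_(x <- s) x.2 = 1%:M ->
  char_poly (\sum_(x <- s) x.1 *: x.2)
    = \prod_(x <- s) ('X - x.1%:P) ^+ \rank x.2.
Proof.
move=> idem orth sum1; pose f x : {poly F} * 'M[F]_n := ('X - x.1%:P - 1, x.2).
transitivity (\prod_(y <- map f s) (1 + y.1) ^+ \rank y.2); last first.
  by rewrite big_map; apply: eq_bigr => x _; rewrite addrC subrK.
rewrite -det_add1_idempotents; first last.
- by rewrite pairwise_map.
- by move=> _ /mapP[x xs ->]; apply: idem.
have sumE p : p%:M = \sum_(x <- s) p *: map_mx polyC x.2.
  by rewrite -scaler_sumr -raddf_sum sum1 /= map_mx1 scalemx1.
rewrite big_map /char_poly /char_poly_mx !sumE raddf_sum -sumrB -big_split /=.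
congr (\det _); apply: eq_bigr => x _.
by rewrite map_mxZ -scalerBl -scalerDl [1 + _]addrC subrK.
Qed.

End Idempotents.

(** The multiplication table and the traces alone determine the spectrum. Both sides of [tc] count
    points, and [r * c] counts blocks. The multiplicities are existential because they arise as
    ranks. *)
Lemma char_poly_block_algebra (R : realFieldType) (n : nat) (U W J : 'M[R]_n)
    (t r c : R)
    (t0 : t != 0) (c0 : c != 0) (r0 : r != 0) (r1 : r != 1)
    (tc : t * c = r * (t - 1) + 1)
    (JJ : J *m J = (r * c) *: J) (JU : J *m U = (t * r) *: J)
    (UJ : U *m J = (t * r) *: J) (JW : J *m W = c *: J) (WJ : W *m J = c *: J)
    (UW : U *m W = t *: J) (WU : W *m U = t *: J)
    (UU : U *m U = (r - 1) *: U + t ^+ 2 *: J) (WW : W *m W = c *: W)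
    (trJ : \tr J = r * c) (trU : \tr U = r * c * t) (trW : \tr W = r * c)
    (n_rc : n%:R = r * c) :
  exists f1 f2 f3 : nat,
    [/\ f1%:R = r - 1, f2%:R = t * c - 1,
        f3%:R = (t * c - 1) / t * (r - 1 - t)
      & char_poly (U + W - (t + 1)%:M)
        = \prod_(a <- nseq 1 (t * r + c - t - 1) ++ nseq f1 (c - t - 1)
                      ++ nseq f2 (r - t - 2) ++ nseq f3 (- t - 1))
             ('X - a%:P)].
Proof.
(* Eliminating [c] leaves identities in the independent quantities [t] and [r], as [field] requires;
   [d0] is what remains of [c != 0]. *)
have {tc} cE : c = (r * (t - 1) + 1) / t by rewrite -tc mulrAC divff ?mul1r.
have d0 : r * (t - 1) + 1 != 0.
  by apply: contraNneq c0 => d0; rewrite cE d0 mul0r.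
have r1' : r - 1 != 0 by rewrite subr_eq0.
(* The projections onto the constants, onto the rest of the row space of [C], onto the rest of the
   row space of [N], and onto the complement. [U] acts on constants as [t * r], whence the
   correction in [E2]. *)
pose E0 := (r * c)^-1 *: J.
pose E1 := c^-1 *: W - E0.
pose E2 := (r - 1)^-1 *: U - (t * r / (r - 1)) *: E0.
pose E3 := 1%:M - E0 - E1 - E2.
(* With this table each product of idempotents becomes a linear combination of [U], [W] and [J],
   compared entry by entry. *)
have mulE := (mulmxBl, mulmxBr, mul1mx, mulmx1, scalerBr, (JJ, JU, UJ), (JW, WJ),
  (UW, WU, UU, WW)).
pose zE := (=^~ scalemxAl, =^~ scalemxAr).
have E00 : E0 *m E0 = E0.
  rewrite /E0 !(zE, mulE); apply/matrixP => i j; rewrite !mxE cE.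
  by field; rewrite t0 r0 d0.
have E11 : E1 *m E1 = E1.
  rewrite /E1 /E0 !(zE, mulE); apply/matrixP => i j; rewrite !mxE cE.
  by field; rewrite t0 r0 d0.
have E22 : E2 *m E2 = E2.
  rewrite /E2 /E0 !(zE, mulE); apply/matrixP => i j; rewrite !mxE cE.
  by field; rewrite t0 r0 r1' d0.
have E01 : E0 *m E1 = 0.
  rewrite /E1 /E0 !(zE, mulE); apply/matrixP => i j; rewrite !mxE cE.
  by field; rewrite t0 r0 d0.
have E10 : E1 *m E0 = 0.
  rewrite /E1 /E0 !(zE, mulE); apply/matrixP => i j; rewrite !mxE cE.
  by field; rewrite t0 r0 d0.
have E02 : E0 *m E2 = 0.
  rewrite /E2 /E0 !(zE, mulE); apply/matrixP => i j; rewrite !mxE cE.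
  by field; rewrite t0 r0 r1' d0.
have E20 : E2 *m E0 = 0.
  rewrite /E2 /E0 !(zE, mulE); apply/matrixP => i j; rewrite !mxE cE.
  by field; rewrite t0 r0 r1' d0.
have E12 : E1 *m E2 = 0.
  rewrite /E2 /E1 /E0 !(zE, mulE); apply/matrixP => i j; rewrite !mxE cE.
  by field; rewrite t0 r0 r1' d0.
have E21 : E2 *m E1 = 0.
  rewrite /E2 /E1 /E0 !(zE, mulE); apply/matrixP => i j; rewrite !mxE cE.
  by field; rewrite t0 r0 r1' d0.
have Ei3 : [/\ E0 *m E3 = 0, E1 *m E3 = 0 & E2 *m E3 = 0].
  split; rewrite /E3 (mulmxBr _ _ E2) (mulmxBr _ _ E1) (mulmxBr _ _ E0) mulmx1;
  by rewrite !(E00, E01, E02, E10, E11, E12, E20, E21, E22, subr0, subrr).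
have [E03 E13 E23] := Ei3.
have E33 : E3 *m E3 = E3.
  rewrite {1}/E3 (mulmxBl _ E2) (mulmxBl _ E1) (mulmxBl _ E0) mul1mx.
  by rewrite E03 E13 E23 !subr0.
have tr0 : \tr E0 = 1 by rewrite mxtraceZ trJ mulVf ?mulf_neq0.
have tr1 : \tr E1 = r - 1.
  by rewrite raddfB /= mxtraceZ trW tr0; field.
have tr2 : \tr E2 = t * c - 1.
  rewrite raddfB /= !mxtraceZ trU trJ cE; field.
  by rewrite t0 r0 r1' d0.
have tr3 : \tr E3 = (t * c - 1) / t * (r - 1 - t).
  rewrite 3!raddfB /= mxtrace1 tr0 tr1 tr2 n_rc cE; field.
  exact: t0.
exists (\rank E1), (\rank E2), (\rank E3).
rewrite -!mxtrace_idempotent // tr1 tr2 tr3; split=> //.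
(* [U] is 0 on the image of [E1] and [r - 1] on that of [E2]; [W] is [c] and 0 there; both vanish on
   the image of [E3]. Subtracting [t + 1] gives the eigenvalues. *)
pose s := [:: (t * r + c - t - 1, E0); (c - t - 1, E1); (r - t - 2, E2);
              (- t - 1, E3)].
have rk0 : \rank E0 = 1%N.
  by apply/eqP; rewrite -(@eqr_nat R) -mxtrace_idempotent // tr0.
transitivity (char_poly (\sum_(x <- s) x.1 *: x.2)).
  congr char_poly; rewrite !big_cons big_nil addr0 /= /E3 /E2 /E1 /E0.
  apply/matrixP => i j; rewrite !mxE -mulr_natr cE; field.
  by rewrite t0 r0 r1' d0.
rewrite char_poly_idempotents.
- by rewrite !big_cat !big_nseq !big_cons big_nil /= !iter_mulr_1 rk0 !mulr1.
- move=> x; rewrite !inE.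
  by move=> /or4P[] /eqP-> /=.
- by rewrite /= E01 E02 E03 E12 E13 E23 !eqxx.
- rewrite !big_cons big_nil /= addr0 /E3.
  by rewrite [E2 + _]addrC subrK [E1 + _]addrC subrK addrC subrK.
Qed.

(** Walks of length two are counted; on the diagonal this gives the degree. *)
Lemma adjmx_sqrE (R : nzRingType) (G : sgraph) (i j : 'I_#|G|) :
  (adjmx R G *m adjmx R G) i j = (common_nbrs (enum_val i) (enum_val j))%:R.
Proof.
rewrite mxE /common_nbrs -sum1_card natr_sum [RHS]big_mkcond /=.
rewrite [RHS](big_enum_val (A := G)); apply: eq_bigr => k _; rewrite !mxE inE.
by rewrite [adj (enum_val k) _]adj_sym -natrM mulnb; case: (_ && _).
Qed.

(** * Incidence counts in a resolved design *)

Section Incidence.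
Variables (R : realFieldType) (P : finType) (v t : nat).
Variables (B : {set {set P}}) (Q : {set {set {set P}}}).
Hypotheses (t_gt1 : (1 < t)%N) (designB : design2 v t B).
Hypothesis resolQ : resolution B Q.

Let H := block_graph B Q.
Let vR : R := v%:R.
Let tR : R := t%:R.
(** [r] is the replication number ([sum_blocks_point]) and [c] the size of a parallel class
    ([class_size]). *)
Let r : R := (vR - 1) / (tR - 1).
Let c : R := vR / tR.

Definition block_of (x : H) : {set P} := val (x : {b : {set P} | b \in B}).

(** Unlike adjacency, this holds between a block and itself, so that it gives the entries of
    [C^T *m C]. *)
Definition parallel (b1 b2 : {set P}) : bool :=
  [exists C in Q, (b1 \in C) && (b2 \in C)].

Definition point_block_mx : 'M[R]_(#|P|, #|H|) :=
  \matrix_(i, j) ((enum_val i : P) \in block_of (enum_val j))%:R.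

Definition class_block_mx : 'M[R]_(#|Q|, #|H|) :=
  \matrix_(i, j) (block_of (enum_val j) \in (enum_val i : {set {set P}}))%:R.

Local Notation N := point_block_mx.
Local Notation C := class_block_mx.
Local Notation ones k := (const_mx 1 : 'cV[R]_k).

Lemma block_of_in (x : H) : block_of x \in B.
Proof. exact: valP. Qed.

Lemma block_of_inj : injective block_of.
Proof. exact: val_inj. Qed.

Let tR_neq0 : tR != 0.
Proof. by rewrite pnatr_eq0 -lt0n ltnW. Qed.

Let tR_neq1 : tR - 1 != 0.
Proof. by rewrite subr_eq0 pnatr_eq1 gtn_eqF. Qed.

Lemma sum_vertices (F : H -> R) :
  \sum_(j < #|H|) F (enum_val j) = \sum_(x : H) F x.
Proof. by rewrite -(big_enum_val F). Qed.

Lemma sum_blocks (F : {set P} -> R) :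
  \sum_(j < #|H|) F (block_of (enum_val j)) = \sum_(b in B) F b.
Proof. rewrite (sum_vertices (F \o block_of)). by rewrite [RHS]big_sub. Qed.

Lemma sum_points (F : P -> R) :
  \sum_(i < #|P|) F (enum_val i) = \sum_x F x.
Proof. by rewrite -(big_enum_val F). Qed.

Lemma sum_classes (F : {set {set P}} -> R) :
  \sum_(i < #|Q|) F (enum_val i) = \sum_(D in Q) F D.
Proof. by rewrite -(big_enum_val F). Qed.

Lemma sum_mem (T : finType) (A D : {set T}) :
  \sum_(x in A) (x \in D)%:R = #|A :&: D|%:R :> R.
Proof.
rewrite -sum1_card natr_sum (big_setID D) /= addrC big1 ?add0r => [|x].
  by apply: eq_bigr => x; rewrite inE => /andP[_ ->].
by rewrite inE => /andP[/negPf->].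
Qed.

Lemma sum_partition (T : finType) (D : {set {set T}}) (X : {set T}) (x : T) :
  partition D X -> x \in X -> \sum_(A in D) (x \in A)%:R = 1 :> R.
Proof.
move=> partD xX; have xD : x \in cover D by rewrite (cover_partition partD).
have trD := partition_trivIset partD.
rewrite (bigD1 (pblock D x)) ?pblock_mem //= mem_pblock xD big1 ?addr0 // => A.
case/andP=> AD; apply: contraNeq; rewrite pnatr_eq0 eqb0 negbK => xA.
by rewrite (def_pblock trD AD xA).
Qed.

Lemma card_point : #|P|%:R = vR.
Proof. by case: designB => ->. Qed.

Lemma block_size b : b \in B -> \sum_x (x \in b)%:R = tR.
Proof.
case: designB => _ size_b _ bB.
rewrite /tR -(size_b _ bB) -[in RHS](setTI b) -sum_mem.
by apply: eq_bigl => x; rewrite inE.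
Qed.

Lemma sum_blocks_pair x y :
  x != y -> \sum_(b in B) (x \in b)%:R * (y \in b)%:R = 1 :> R.
Proof.
case: designB => _ _ pairB /pairB xy1; rewrite -[RHS](congr1 (GRing.natmul 1) xy1).
rewrite setIdE -sum_mem; apply: eq_bigr => b _.
by rewrite inE -natrM mulnb.
Qed.

(** Count the pairs [(y, b)] with [x] and [y] in [b]. By blocks there are [s * t]; by points,
    [y = x] gives [s] and each other point gives 1. *)
Lemma sum_blocks_point x : \sum_(b in B) (x \in b)%:R = r.
Proof.
set s := \sum_(b in B) _.
have : s * tR = s + (vR - 1).
  transitivity (\sum_y \sum_(b in B) (x \in b)%:R * (y \in b)%:R : R).
    rewrite exchange_big mulr_suml; apply: eq_bigr => b bB.
    by rewrite -mulr_sumr block_size.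
  rewrite (bigD1 x) //=; congr (_ + _).
    by apply: eq_bigr => b _; case: (x \in b); rewrite ?mulr1 ?mulr0.
  under eq_bigr => y /[1!eq_sym] xy do rewrite sum_blocks_pair //.
  have -> : vR = 1 + \sum_(y | y != x) 1.
    by rewrite -card_point -sum1_card natr_sum (bigD1 x).
  by rewrite addrC addKr.
by move=> sE; rewrite /r -[LHS](mulfK tR_neq1) mulrBr mulr1 sE addrC addKr.
Qed.

Lemma class_sub D : D \in Q -> D \subset B.
Proof.
case: resolQ => partQ _ DQ; rewrite -(cover_partition partQ).
exact: bigcup_sup DQ.
Qed.

Lemma class_size D : D \in Q -> #|D|%:R = c.
Proof.
move=> DQ; case: resolQ designB => _ /(_ _ DQ) partD [cardP size_b _].
have size_D : {in D, forall b : {set P}, #|b| = t}.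
  by move=> b /(subsetP (class_sub DQ)) /size_b.
have := card_uniform_partition size_D partD.
by rewrite cardsT cardP /c /vR => ->; rewrite natrM mulfK.
Qed.

Lemma sum_blocks_class D :
  D \in Q -> \sum_(b in B) (b \in D)%:R = c.
Proof. by move=> DQ; rewrite sum_mem (setIidPr (class_sub DQ)) class_size. Qed.

Lemma sum_classes_block b : b \in B -> \sum_(D in Q) (b \in D)%:R = 1 :> R.
Proof. by case: resolQ => partQ _; apply: sum_partition. Qed.

Lemma sum_blocks_point_class x D :
  D \in Q -> \sum_(b in B) (x \in b)%:R * (b \in D)%:R = 1 :> R.
Proof.
move=> DQ; case: resolQ => _ /(_ _ DQ) partD.
rewrite -[RHS](sum_partition partD (in_setT x)) (big_setID D) /=.
rewrite (setIidPr (class_sub DQ)) addrC big1 ?add0r => [|b].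
  by apply: eq_bigr => b ->; rewrite mulr1.
by rewrite inE => /andP[/negPf-> _]; rewrite mulr0.
Qed.

Lemma class_unique b D1 D2 :
  D1 \in Q -> D2 \in Q -> b \in D1 -> b \in D2 -> D1 = D2.
Proof.
case: resolQ => /partition_trivIset trQ _ D1Q D2Q bD1 bD2.
by rewrite -(def_pblock trQ D1Q bD1) (def_pblock trQ D2Q bD2).
Qed.

Lemma sum_blocks_class_pair D1 D2 : D1 \in Q -> D2 \in Q ->
  \sum_(b in B) (b \in D1)%:R * (b \in D2)%:R = c *+ (D1 == D2).
Proof.
move=> D1Q D2Q; case: eqVneq => [<-|neqD].
  rewrite -(sum_blocks_class D1Q); apply: eq_bigr => b _.
  by case: (b \in D1); rewrite ?mulr1 ?mulr0.
rewrite big1 // => b _; case bD1: (b \in D1); last by rewrite mul0r.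
case bD2: (b \in D2); last by rewrite mulr0.
by rewrite (class_unique D1Q D2Q bD1 bD2) eqxx in neqD.
Qed.

Lemma sum_classes_pair b1 b2 : b1 \in B ->
  \sum_(D in Q) (b1 \in D)%:R * (b2 \in D)%:R = (parallel b1 b2)%:R :> R.
Proof.
move=> b1B.
case: (boolP (parallel b1 b2)) => [/existsP[D /and3P[DQ b1D b2D]]|nparallel].
  rewrite (bigD1 D) //= b1D b2D mulr1 big1 ?addr0 // => D' /andP[D'Q].
  case b1D': (b1 \in D'); last by rewrite mul0r.
  by rewrite (class_unique DQ D'Q b1D b1D') eqxx.
rewrite big1 // => D DQ; rewrite -natrM mulnb.
case: andP => // -[b1D b2D]; case/negP: nparallel.
by apply/existsP; exists D; apply/and3P.
Qed.

Lemma sum_points_pair (b1 b2 : {set P}) :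
  \sum_x (x \in b1)%:R * (x \in b2)%:R = #|b1 :&: b2|%:R :> R.
Proof.
rewrite -(setTI (b1 :&: b2)) -sum_mem.
by apply: eq_big => x; rewrite ?inE // -natrM mulnb.
Qed.

Lemma card_meet_le1 (b1 b2 : {set P}) :
  b1 \in B -> b2 \in B -> b1 != b2 -> (#|b1 :&: b2| <= 1)%N.
Proof.
move=> b1B b2B; apply: contraNT; rewrite -ltnNge => /card_gt1P[x [y [xb yb xy]]].
case: designB => _ _ /(_ _ _ xy) /eqP/cards1P[b0 bE]; move: xb yb.
rewrite !inE => /andP[x1 x2] /andP[y1 y2].
have: b1 \in [set b0] by rewrite -bE inE b1B x1.
have: b2 \in [set b0] by rewrite -bE inE b2B x2.
by rewrite !inE => /eqP-> /eqP->.
Qed.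

Lemma parallel_disjoint b1 b2 : parallel b1 b2 -> b1 != b2 -> b1 :&: b2 = set0.
Proof.
case/existsP=> D /and3P[DQ b1D b2D] neq_b; case: resolQ => _ /(_ _ DQ) partD.
have /trivIsetP trD := partition_trivIset partD.
by apply/eqP; rewrite setI_eq0; apply: trD.
Qed.

Lemma parallel_refl b : b \in B -> parallel b b.
Proof.
case: resolQ => partQ _; rewrite -(cover_partition partQ) => /bigcupP[D DQ bD].
by apply/existsP; exists D; rewrite DQ bD.
Qed.

Lemma adjE (x y : H) : adj x y =
  (x != y) && ((block_of x :&: block_of y != set0)
                || parallel (block_of x) (block_of y)).
Proof. by []. Qed.

(** Distinct blocks share at most one point, and none if parallel, so the first two terms sum to 0
    or 1. On the diagonal they sum to [t + 1]. *)
Lemma natr_adj (x y : H) :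
  (adj x y)%:R = #|block_of x :&: block_of y|%:R
                 + (parallel (block_of x) (block_of y))%:R
                 - (tR + 1) *+ (x == y) :> R.
Proof.
rewrite adjE; case: (eqVneq x y) => [<-|neq_xy] /=.
  rewrite setIid parallel_refl ?block_of_in //.
  by case: designB => _ /(_ _ (block_of_in x)) -> _; rewrite subrr.
have neq_b : block_of x != block_of y by rewrite (inj_eq block_of_inj).
rewrite subr0; case par: parallel.
  by rewrite (parallel_disjoint par neq_b) eqxx cards0 add0r.
rewrite orbF addr0 -card_gt0.
by have := card_meet_le1 (block_of_in x) (block_of_in y) neq_b; case: #|_| => [|[]].
Qed.

(** * Incidence matrices and the adjacency matrix *)

Lemma point_block_trmx_mulE i j : (N^T *m N) i j =
  #|block_of (enum_val i) :&: block_of (enum_val j)|%:R.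
Proof.
rewrite mxE -sum_points_pair -sum_points.
by apply: eq_bigr => k _; rewrite !mxE.
Qed.

Lemma class_block_trmx_mulE i j : (C^T *m C) i j =
  (parallel (block_of (enum_val i)) (block_of (enum_val j)))%:R.
Proof.
rewrite mxE -sum_classes_pair ?block_of_in // -sum_classes.
by apply: eq_bigr => k _; rewrite !mxE.
Qed.

Lemma adjmx_block_graph : adjmx R H = N^T *m N + C^T *m C - (tR + 1)%:M.
Proof.
apply/matrixP=> i j; rewrite [LHS]mxE natr_adj (inj_eq enum_val_inj).
rewrite -point_block_trmx_mulE -class_block_trmx_mulE.
(* Generalising the products keeps [mxE] from expanding them into sums. *)
by move: (N^T *m N) (C^T *m C) => U W; rewrite !mxE.
Qed.

Lemma mul_point_block_trmx : N *m N^T = (r - 1)%:M + const_mx 1.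
Proof.
apply/matrixP => i j; rewrite !mxE.
under eq_bigr => k _ do rewrite !mxE.
rewrite (sum_blocks (fun b => ((enum_val i : P) \in b)%:R
                              * ((enum_val j : P) \in b)%:R)).
case: (eqVneq i j) => [<-|neq_ij].
  rewrite mulr1n subrK -(sum_blocks_point (enum_val i)).
  by apply: eq_bigr => b _; case: (_ \in _); rewrite ?mulr1 ?mulr0.
by rewrite add0r sum_blocks_pair // (inj_eq enum_val_inj).
Qed.

Lemma mul_class_block_trmx : C *m C^T = c%:M.
Proof.
apply/matrixP => i j; rewrite !mxE.
under eq_bigr => k _ do rewrite !mxE.
rewrite (sum_blocks (fun b => (b \in (enum_val i : {set {set P}}))%:R
                              * (b \in (enum_val j : {set {set P}}))%:R)).
by rewrite sum_blocks_class_pair ?enum_valP // (inj_eq enum_val_inj).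
Qed.

Lemma mul_point_block_class_block_trmx : N *m C^T = const_mx 1.
Proof.
apply/matrixP => i j; rewrite !mxE.
under eq_bigr => k _ do rewrite !mxE.
rewrite (sum_blocks (fun b => ((enum_val i : P) \in b)%:R
                              * (b \in (enum_val j : {set {set P}}))%:R)).
by rewrite sum_blocks_point_class ?enum_valP.
Qed.

Lemma point_block_trmx_ones : N^T *m ones _ = tR *: ones _.
Proof.
apply/matrixP => i j; rewrite !mxE mulr1.
under eq_bigr => k _ do rewrite !mxE mulr1.
rewrite (sum_points (fun x => (x \in block_of (enum_val i))%:R)).
exact/block_size/block_of_in.
Qed.

Lemma class_block_trmx_ones : C^T *m ones _ = ones _.
Proof.
apply/matrixP => i j; rewrite !mxE.
under eq_bigr => k _ do rewrite !mxE mulr1.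
rewrite (sum_classes (fun D => (block_of (enum_val i) \in D)%:R)).
exact/sum_classes_block/block_of_in.
Qed.

Lemma point_block_ones : N *m ones _ = r *: ones _.
Proof.
apply/matrixP => i j; rewrite !mxE mulr1.
under eq_bigr => k _ do rewrite !mxE mulr1.
by rewrite (sum_blocks (fun b => ((enum_val i : P) \in b)%:R)) sum_blocks_point.
Qed.

Lemma class_block_ones : C *m ones _ = c *: ones _.
Proof.
by rewrite -class_block_trmx_ones mulmxA mul_class_block_trmx mul_scalar_mx.
Qed.

(** Counting flags by points and by blocks, as two evaluations of [1^T N 1], gives
    [v * r = #|H| * t]. *)
Lemma card_block_graph : #|H|%:R = r * c.
Proof.
have /matrixP/(_ 0 0) : (ones _)^T *m N *m ones _ = (v%:R * r)%:M :> 'M[R]_1.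
  rewrite -mulmxA point_block_ones -scalemxAr; apply/matrixP => i j.
  by rewrite !ord1 !mxE (eq_bigr (fun=> 1)) => [|k _]; rewrite ?mxE ?mulr1 //
             sumr_const card_ord card_point mulrC.
rewrite -[_ *m N]trmxK trmx_mul trmxK point_block_trmx_ones linearZ /= -scalemxAl.
rewrite !mxE (eq_bigr (fun=> 1)) => [|k _]; last by rewrite !mxE mulr1.
rewrite sumr_const card_ord /c => tn.
apply: (mulfI tR_neq0); rewrite tn eqxx mulr1n; field.
exact: tR_neq0.
Qed.

(** * Multiplication table and traces of [U], [W] and [J] *)

Local Notation U := (N^T *m N).
Local Notation W := (C^T *m C).
Local Notation J := (const_mx 1 : 'M[R]_#|H|).

(** This rank-one form reduces products with [J] to row sums. *)
Lemma const_mx1E m n : const_mx 1 = ones m *m (ones n)^T.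
Proof. by apply/matrixP => i j; rewrite !mxE big_ord1 !mxE mulr1. Qed.

(** By symmetry of [U] and [W], each product in reverse order follows by transposition. *)
Lemma trmx_gram m (M : 'M[R]_(m, #|H|)) : (M^T *m M)^T = M^T *m M.
Proof. by rewrite trmx_mul trmxK. Qed.

Lemma mul_JJ : J *m J = (r * c) *: J.
Proof.
apply/matrixP => i j; rewrite !mxE (eq_bigr (fun=> 1)) => [|k _].
  by rewrite sumr_const card_ord card_block_graph mulr1.
by rewrite !mxE mulr1.
Qed.

Lemma mul_UJ : U *m J = (tR * r) *: J.
Proof.
rewrite const_mx1E mulmxA -(mulmxA _ N) point_block_ones -scalemxAr.
by rewrite point_block_trmx_ones scalerA mulrC -scalemxAl.
Qed.

Lemma mul_JU : J *m U = (tR * r) *: J.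
Proof. by apply: trmx_inj; rewrite trmx_mul trmx_gram linearZ /= !trmx_const mul_UJ. Qed.

Lemma mul_WJ : W *m J = c *: J.
Proof.
rewrite const_mx1E mulmxA -(mulmxA _ C) class_block_ones -scalemxAr.
by rewrite class_block_trmx_ones -scalemxAl.
Qed.

Lemma mul_JW : J *m W = c *: J.
Proof. by apply: trmx_inj; rewrite trmx_mul trmx_gram linearZ /= !trmx_const mul_WJ. Qed.

Lemma mul_UW : U *m W = tR *: J.
Proof.
rewrite mulmxA -(mulmxA _ N) mul_point_block_class_block_trmx const_mx1E mulmxA.
rewrite point_block_trmx_ones -mulmxA -[_ *m C]trmxK trmx_mul trmxK.
by rewrite class_block_trmx_ones -scalemxAl -const_mx1E.
Qed.

Lemma mul_WU : W *m U = tR *: J.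
Proof. by apply: trmx_inj; rewrite trmx_mul !trmx_gram linearZ /= !trmx_const mul_UW. Qed.

Lemma mul_UU : U *m U = (r - 1) *: U + tR ^+ 2 *: J.
Proof.
rewrite mulmxA -(mulmxA _ N) mul_point_block_trmx mulmxDr mulmxDl mul_mx_scalar.
rewrite -scalemxAl; congr (_ + _).
rewrite const_mx1E mulmxA point_block_trmx_ones -mulmxA -[_ *m N]trmxK trmx_mul trmxK.
by rewrite point_block_trmx_ones linearZ /= -scalemxAl -scalemxAr scalerA -const_mx1E.
Qed.

Lemma mul_WW : W *m W = c *: W.
Proof.
by rewrite mulmxA -(mulmxA _ C) mul_class_block_trmx mul_mx_scalar -scalemxAl.
Qed.

Lemma mxtrace_U : \tr U = r * c * tR.
Proof.
rewrite /mxtrace (eq_bigr (fun=> tR)) => [|i _].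
  by rewrite sumr_const card_ord -mulr_natl card_block_graph.
rewrite point_block_trmx_mulE setIid.
by case: designB => _ size_b _; rewrite size_b ?block_of_in.
Qed.

Lemma mxtrace_W : \tr W = r * c.
Proof.
rewrite /mxtrace (eq_bigr (fun=> 1)) => [|i _].
  by rewrite sumr_const card_ord card_block_graph.
by rewrite class_block_trmx_mulE parallel_refl ?block_of_in.
Qed.

Lemma mxtrace_J : \tr J = r * c.
Proof.
rewrite /mxtrace (eq_bigr (fun=> 1)) => [|i _]; last by rewrite mxE.
by rewrite sumr_const card_ord card_block_graph.
Qed.

(** The coefficient of [J] collects [t ^ 2] from [U *m U] and [2 * t] from the two mixed
    products. *)
Lemma sqr_adjmx_block_graph : adjmx R H *m adjmx R H =
  (r - 2 * tR - 3) *: U + (c - 2 * tR - 2) *: W + (tR * (tR + 2)) *: J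
  + ((tR + 1) ^+ 2)%:M.
Proof.
rewrite adjmx_block_graph !(mulmxBl, mulmxBr, mulmxDl, mulmxDr).
rewrite mul_UU mul_WW mul_UW mul_WU !mul_mx_scalar !mul_scalar_mx.
move: U W => U0 W0; apply/matrixP => i j; rewrite !mxE -[in RHS]mulr_natr.
by rewrite -[in LHS]mulr_natr; ring.
Qed.

(** For distinct non-adjacent blocks only the term [t * (t + 2)] survives; meeting pairs, parallel
    pairs and the diagonal each add one correction. *)
Lemma natr_common_nbrs (x y : H) : (common_nbrs x y)%:R =
  (r - 2 * tR - 3) * #|block_of x :&: block_of y|%:R
  + (c - 2 * tR - 2) * (parallel (block_of x) (block_of y))%:R
  + tR * (tR + 2) + (tR + 1) ^+ 2 *+ (x == y).
Proof.
have /matrixP/(_ (enum_rank x) (enum_rank y)) := sqr_adjmx_block_graph.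
rewrite adjmx_sqrE !enum_rankK => ->.
rewrite -[x in RHS]enum_rankK -[y in RHS]enum_rankK (inj_eq enum_val_inj).
rewrite -point_block_trmx_mulE -class_block_trmx_mulE.
by move: U W => U0 W0; rewrite !mxE mulr1.
Qed.

(** * Existence of both kinds of edges *)

Lemma block_through (x y : P) :
  x != y -> exists2 z : H, x \in block_of z & y \in block_of z.
Proof.
case: designB => _ _ pairB /pairB /eqP/cards1P[b bE].
have : b \in [set b] by rewrite inE.
rewrite -bE !inE => /and3P[bB xb yb].
by exists (exist _ b bB : {b : {set P} | b \in B}).
Qed.

Hypothesis t_lt_v : (t < v)%N.

Lemma card_block_graph_gt0 : (0 < #|H|)%N.
Proof.
have : (1 < #|P|)%N by case: designB => -> _ _; apply: ltn_trans t_lt_v.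
move=> /card_gt1P[x [y [_ _ /block_through[z _ _]]]].
by apply/card_gt0P; exists z.
Qed.

Lemma outside_point (z : H) : exists y, y \notin block_of z.
Proof.
have /subsetPn[y _ yz] : ~~ ([set: P] \subset block_of z).
  apply: contraL t_lt_v => /subset_leq_card; rewrite cardsT -leqNgt.
  by case: designB => -> /(_ _ (block_of_in z)) ->.
by exists y.
Qed.

Lemma inside_point (z : H) : exists x, x \in block_of z.
Proof.
apply/card_gt0P; case: designB => _ /(_ _ (block_of_in z)) -> _.
exact: ltn_trans t_gt1.
Qed.

(** Join a point of a block to a point outside it. *)
Lemma exists_meeting :
  exists x y : H, x != y /\ block_of x :&: block_of y != set0.
Proof.
have /card_gt0P[x _] := card_block_graph_gt0; have [p px] := inside_point x.
have [q qx] := outside_point x.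
have /block_through[y py qy] : p != q by apply: contraNneq qx => <-.
exists x, y; split; first by apply: contraNneq qx => ->.
by apply/set0Pn; exists p; rewrite inE px.
Qed.

(** In the class of a block, take the block covering a point outside it. *)
Lemma exists_parallel :
  exists x y : H, x != y /\ parallel (block_of x) (block_of y).
Proof.
have /card_gt0P[x _] := card_block_graph_gt0; have [q qx] := outside_point x.
have /existsP[D /and3P[DQ xD _]] := parallel_refl (block_of_in x).
have : q \in cover D.
  by case: resolQ => _ /(_ _ DQ)/cover_partition->; rewrite inE.
case/bigcupP=> b bD qb; have bB := subsetP (class_sub DQ) b bD.
exists x, (exist _ b bB : {b : {set P} | b \in B}); split.
  by apply: contraNneq qx => ->.
by apply/existsP; exists D; rewrite DQ xD bD.
Qed.

End Incidence.

(** * Valency, co-edge-regularity, level and spectrum *)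

Theorem theorem4p4 (R : realFieldType) (P : finType) (v t : nat)
    (B : {set {set P}}) (Q : {set {set {set P}}})
    (t_gt1 : (1 < t)%N) (t_lt_v : (t < v)%N)
    (designB : design2 v t B) (resolQ : resolution B Q) :
  let H := block_graph B Q in
  let vR : R := v%:R in
  let tR : R := t%:R in
  let valency : R := (vR - tR) / (tR - 1) * (tR + (tR - 1) / tR) in
  (exists2 k : nat, k%:R = valency & regular_graph H k) /\
  co_edge_regular H (t * (t + 2))%N /\
  (v != t ^ 2 -> level H = 2)%N /\
  (exists f1 f2 f3 : nat,
    [/\ f1%:R = (vR - tR) / (tR - 1),
        f2%:R = vR - 1,
        f3%:R = (vR - 1) / tR * ((vR - tR) / (tR - 1) - tR)
      & spectrum H (nseq 1 valency
                    ++ nseq f1 ((vR - tR) / tR - tR)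
                    ++ nseq f2 ((vR - 1) / (tR - 1) - tR - 2%:R)
                    ++ nseq f3 (- tR - 1))]).
Proof.
move=> H vR tR valency.
have tR0 : tR != 0 by rewrite pnatr_eq0 -lt0n ltnW.
have tR1 : tR - 1 != 0 by rewrite subr_eq0 pnatr_eq1 gtn_eqF.
have vR0 : vR != 0 by rewrite pnatr_eq0 -lt0n (leq_trans _ t_lt_v).
have vR1 : vR - 1 != 0 by rewrite subr_eq0 pnatr_eq1 gtn_eqF // (ltn_trans t_gt1).
have vRtR : vR != tR by rewrite eqr_nat gtn_eqF.
have common := natr_common_nbrs R t_gt1 designB resolQ.
have degree x : #|[set y : H | adj x y]|%:R = valency.
  have -> : #|[set y : H | adj x y]| = common_nbrs x x.
    by apply: eq_card => y; rewrite !inE andbb.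
  rewrite common eqxx setIid (parallel_refl resolQ) ?block_of_in //.
  case: designB => _ -> //; last exact: block_of_in.
  by move=> _; rewrite /valency -/tR -/vR /=; field; rewrite tR0 tR1.
have /card_gt0P[x0 _] := card_block_graph_gt0 Q t_gt1 designB t_lt_v.
have reg : exists2 k : nat, k%:R = valency & regular_graph H k.
  (* The valency is an element of [R], so its natural number witness is the degree of an actual
     vertex. *)
  exists #|[set y | adj x0 y]|; first exact: degree.
  by move=> x; apply/eqP; rewrite -(eqr_nat R) !degree.
split=> //; split.
  split=> [|x y neq_xy]; first by case: reg => k _ kP; exists k.
  rewrite adjE neq_xy negb_or negbK => /andP[/eqP meet0 /negPf par0].
  apply/eqP; rewrite -(eqr_nat R) common meet0 par0 cards0 (negPf neq_xy).
  rewrite -/tR -/vR /=.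
  by rewrite natrM natrD; apply/eqP; ring.
split.
  move=> v_neq.
  (* The common neighbour counts of meeting pairs and of parallel pairs. *)
  pose lm : R := (vR - 1) / (tR - 1) - 3 + tR ^+ 2.
  pose lp : R := vR / tR - 2 + tR ^+ 2.
  have common_meet (x y : H) : x != y -> block_of x :&: block_of y != set0 ->
      (common_nbrs x y)%:R = lm.
    move=> neq_xy meet; rewrite common (negPf neq_xy).
    have neq_b : block_of x != block_of y by rewrite (inj_eq (@block_of_inj _ _ _)).
    have := card_meet_le1 designB (block_of_in x) (block_of_in y) neq_b.
    rewrite leq_eqVlt ltnS leqn0 cards_eq0 (negPf meet) orbF => /eqP->.
    case par: parallel; last by rewrite /lm -/tR -/vR /=; field; rewrite ?tR0 ?tR1.
    by rewrite (parallel_disjoint resolQ par neq_b) eqxx in meet.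
  have common_par (x y : H) : x != y -> parallel Q (block_of x) (block_of y) ->
      (common_nbrs x y)%:R = lp.
    move=> neq_xy par; rewrite common (negPf neq_xy) par.
    have neq_b : block_of x != block_of y by rewrite (inj_eq (@block_of_inj _ _ _)).
    rewrite (parallel_disjoint resolQ par neq_b) cards0 /lp -/tR -/vR /=.
    by field; rewrite ?tR0 ?tR1.
  have [x1 [y1 [neq1 meet1]]] := exists_meeting Q t_gt1 designB t_lt_v.
  have [x2 [y2 [neq2 par2]]] := exists_parallel t_gt1 designB resolQ t_lt_v.
  have neq_common : common_nbrs x1 y1 != common_nbrs x2 y2.
    rewrite -(eqr_nat R) common_meet // common_par //.
    apply: contraNneq v_neq => lmp.
    rewrite -(eqr_nat R) natrX -subr_eq0 -/vR -/tR.
    (* Equal counts would force [v = t ^ 2], the case of affine planes, where [H] is complete. *)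
    have -> : vR - tR ^+ 2 = tR * (tR - 1) * (lm - lp).
      by rewrite /lm /lp; field; rewrite tR0 tR1.
    by rewrite lmp subrr mulr0.
  (* Only the set of values matters: each edge is of one of the two kinds, and both occur. *)
  rewrite /level
    (perm_size (perm_undup (s2 := [:: common_nbrs x1 y1; common_nbrs x2 y2]) _)).
    by rewrite /= inE (negPf neq_common).
  move=> k; rewrite !inE; apply/mapP/orP.
    case=> -[x y]; rewrite mem_enum inE adjE /= => /andP[neq_xy].
    case/orP=> [meet|par] ->; [left|right]; rewrite -(eqr_nat R).
      by rewrite !common_meet.
    by rewrite !common_par.
  case=> /eqP->; [exists (x1, y1)|exists (x2, y2)] => //.
    by rewrite mem_enum inE adjE /= neq1 meet1.
  by rewrite mem_enum inE adjE /= neq2 par2 orbT.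
have := @char_poly_block_algebra R #|H| _ _ _ tR ((vR - 1) / (tR - 1)) (vR / tR)
  tR0 _ _ _ _ (mul_JJ R Q t_gt1 designB) (mul_JU R Q t_gt1 designB)
  (mul_UJ R Q t_gt1 designB) (mul_JW R t_gt1 designB resolQ)
  (mul_WJ R t_gt1 designB resolQ) (mul_UW R designB resolQ)
  (mul_WU R designB resolQ) (mul_UU R Q t_gt1 designB)
  (mul_WW R t_gt1 designB resolQ) (mxtrace_J R Q t_gt1 designB)
  (mxtrace_U R Q t_gt1 designB) (mxtrace_W R t_gt1 designB resolQ)
  (card_block_graph R Q t_gt1 designB).
rewrite -(adjmx_block_graph R designB resolQ).
have tc : tR * (vR / tR) = vR by field.
case.
- by rewrite mulf_neq0 ?invr_eq0.
- by rewrite mulf_neq0 ?invr_eq0.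
(* [r != 1] amounts to [v != t]. *)
- rewrite -subr_eq0; have -> : (vR - 1) / (tR - 1) - 1 = (vR - tR) / (tR - 1).
    by field.
  by rewrite mulf_neq0 ?invr_eq0 // subr_eq0.
- by rewrite tc divfK // subrK.
move=> f1 [f2 [f3 []]]; rewrite tc => f1E f2E f3E charE.
exists f1, f2, f3; split=> //.
- by rewrite f1E; field.
- by rewrite f3E; field; rewrite tR0 tR1.
rewrite /spectrum charE; congr (\prod_(a <- _ ++ nseq _ _ ++ _) _).
  by congr [:: _]; rewrite /valency; field; rewrite tR0 tR1.
by field.
Qed.
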